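(* Let $G$ be a graph of order $n$ with minimum degree $\delta(G) \ge 4$. Then $\gamma_{\rm pr}(G) \le \frac{10}{17}n$ (in particular $\gamma_{\rm pr}(G) < 0.5883\, n$).
   Context: All graphs are finite and simple. A set $S \subseteq V(G)$ is a paired dominating set of $G$ if every vertex of $G$ not in $S$ is adjacent to a vertex in $S$ and the induced subgraph $G[S]$ contains a perfect matching (not necessarily induced). The paired domination number $\gamma_{\rm pr}(G)$ is the minimum cardinality of a paired dominating set of $G$. *)

(* Defs.v *)
From mathcomp Require Import all_boot all_order.
Set Implicit Arguments. Unset Strict Implicit. Unset Printing Implicit Defensive.

Definition simple_graph (T : finType) (e : rel T) : Prop :=
  symmetric e /\ irreflexive e.

Definition nbhd (T : finType) (e : rel T) (x : T) : {set T} := [set y | e x y].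
Definition deg (T : finType) (e : rel T) (x : T) : nat := #|nbhd e x|.

Definition min_deg_ge (T : finType) (e : rel T) (k : nat) : Prop :=
  forall x : T, k <= deg e x.

Definition dominating (T : finType) (e : rel T) (S : {set T}) : bool :=
  [forall x, (x \in S) || [exists y in S, e x y]].

Definition perfect_matching_in (T : finType) (e : rel T) (S : {set T})
    (M : {set {set T}}) : bool :=
  [forall m in M, exists x, exists y, (m == [set x; y]) && e x y
                                      && (x \in S) && (y \in S)]
  && trivIset M && (cover M == S).

Definition paired_dominating (T : finType) (e : rel T) (S : {set T}) : bool :=
  dominating e S && [exists M, perfect_matching_in e S M].

(* paired domination number: minimum size of a paired dominating set
   (default #|T| if none exists, which never happens when there are no
   isolated vertices). *)
Definition gamma_pr (T : finType) (e : rel T) : nat :=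
  \big[minn/#|T|]_(S : {set T} | paired_dominating e S) #|S|.

(* Main.v *)
(** Pairs [v w] are picked greedily. Let [W] be the set of vertices not yet
    dominated; a vertex of [W] weighs 50, any other vertex with [j] neighbours
    in [W] weighs [bw j], so the initial weight is [50 n]. A picked edge always
    meets [W], hence both ends are unused: a used vertex has no neighbour in
    [W]. As [n * 50 / 170 * 2 = 10 n / 17], it suffices that some pair removes
    weight 170, or some two pairs remove 340.

    While degrees into [W] are not small, take [v] of large degree into [W],
    inside or outside [W], and let [s x] count the neighbours of [x] in [W] outside [N[v]].
    Choosing as partner a neighbour [w] in [W] with [s w] maximal, every other
    neighbour of [v] keeps at most [s w] neighbours in [W] while [w] brings
    [s w] new vertices, so triangles at [v] cost nothing and the loss is
    bounded in terms of the degree of [v] into [W] and [s w]. Two pairs at once are needed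
    only when [W] is independent and every outside vertex sees at most two
    vertices of [W]. *)
Require Import Defs.
From mathcomp Require Import all_boot all_order.
From mathcomp Require Import zify.
Set Implicit Arguments. Unset Strict Implicit. Unset Printing Implicit Defensive.

(** * Lower bounds for sums *)

Lemma sum_nat_ge_card (T : finType) (A : {set T}) (F : T -> nat) (n k : nat) :
  n <= #|A| -> (forall x, x \in A -> k <= F x) -> n * k <= \sum_(x in A) F x.
Proof.
move=> hn hF; apply: (@leq_trans (\sum_(x in A) k)).
  by rewrite sum_nat_const leq_mul2r hn orbT.
exact: leq_sum.
Qed.

Lemma sum_nat_subset (T : finType) (A B : {set T}) (F : T -> nat) :
  A \subset B -> \sum_(x in A) F x <= \sum_(x in B) F x.
Proof.
by move=> sAB; rewrite [leqRHS](big_setID A) /= (setIidPr sAB) leq_addr.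
Qed.

(* Tight constraints: an isolated vertex of [W] with four private neighbours
   forces [50 + 4 * bw 1 >= 170]; an outside vertex with four neighbours in [W]
   and [s w = 1] forces [bw 4 >= 41]; increments of 4 up to 3 serve the sparse phases. *)
Definition bw (j : nat) : nat :=
  match j with 0 => 0 | 1 => 30 | 2 => 34 | 3 => 38 | _ => 41 end.

Lemma bw_le41 j : bw j <= 41.
Proof. by case: j => [|[|[|[|]]]]. Qed.

Lemma bw_mono i j : i <= j -> bw i <= bw j.
Proof. by case: i => [|[|[|[|i]]]]; case: j => [|[|[|[|j]]]]. Qed.

(** * The weight and its loss when [W] shrinks *)

Section Potential.
Variables (T : finType) (e : rel T).
Hypothesis esym : symmetric e.
Implicit Types (W Z : {set T}) (u v w x y z : T).

Definition wdeg W x := #|nbhd e x :&: W|.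

Definition phi W := \sum_x (if x \in W then 50 else bw (wdeg W x)).

(* Each lost edge between [W] and an outside vertex removes weight at least [D]. *)
Definition steep W D := forall u i, u \notin W -> i <= wdeg W u ->
  bw i + D * (wdeg W u - i) <= bw (wdeg W u).

Lemma steep0 W : steep W 0.
Proof. by move=> u i _ hi; rewrite mul0n addn0 bw_mono. Qed.

(** [bw] grows by 30, 4, 4, 3 and then 0, so bounding the outside degrees by 4 or by 3 yields the
    slopes 3 and 4. *)
Lemma steep3 W : (forall u, u \notin W -> wdeg W u <= 4) -> steep W 3.
Proof.
move=> h u i /h; case: (wdeg W u) i => [|[|[|[|[|k]]]]] // [|[|[|[|[|i]]]]] //.
Qed.

Lemma steep4 W : (forall u, u \notin W -> wdeg W u <= 3) -> steep W 4.
Proof.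
move=> h u i /h; case: (wdeg W u) i => [|[|[|[|k]]]] // [|[|[|[|i]]]] //.
Qed.

Lemma wdeg_sub W W' x : W' \subset W -> wdeg W' x <= wdeg W x.
Proof. by move=> s; apply/subset_leq_card/setIS. Qed.

Lemma wdeg_split W W' x : W' \subset W ->
  wdeg W x = wdeg W' x + wdeg (W :\: W') x.
Proof.
move=> s; rewrite /wdeg -(cardsID W' (nbhd e x :&: W)).
by rewrite -setIA (setIidPr s) setIDA.
Qed.

Lemma sum_wdegC (A X : {set T}) :
  \sum_(u in A) wdeg X u = \sum_(x in X) wdeg A x.
Proof.
have E (B C : {set T}) : \sum_(u in B) wdeg C u = \sum_(u in B) \sum_(x in C) e u x.
  apply: eq_bigr => u _; rewrite /wdeg -sum1_card big_mkcond [RHS]big_mkcond.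
  by apply: eq_bigr => x _; rewrite !inE; case: (e u x); case: (x \in C).
rewrite !E exchange_big; apply: eq_bigr => x _; apply: eq_bigr => u _.
by rewrite esym.
Qed.

(* [Z] is a set of outside vertices losing their whole weight; the edges from
   newly dominated vertices to the remaining outside vertices pay [D] each. *)
Lemma phi_drop W W' Z D :
  W' \subset W -> [disjoint Z & W] -> (forall z, z \in Z -> wdeg W' z = 0) ->
  steep W D ->
  phi W' + \sum_(z in Z) bw (wdeg W z)
    + \sum_(x in W :\: W') (50 - bw (wdeg W' x) + D * #|nbhd e x :\: W :\: Z|)
  <= phi W.
Proof.
move=> sW dZ hZ hD.
rewrite big_split /= -big_distrr /=.
(* Lost edges are regrouped by their outside end; the inequality then holds vertex by vertex. *)
have -> : \sum_(x in W :\: W') #|nbhd e x :\: W :\: Z|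
        = \sum_(u in ~: (W :|: Z)) wdeg (W :\: W') u.
  rewrite sum_wdegC; apply: eq_bigr => x _; apply: eq_card => y.
  by rewrite !inE negb_or; case: (e x y); case: (y \in W); case: (y \in Z).
rewrite big_distrr /= /phi !(big_mkcond (fun x => x \in _)) /= addnA -!big_split /=.
apply: leq_sum => x _; rewrite !inE.
have := wdeg_split x sW; have := hD x (wdeg W' x); have := wdeg_sub x sW.
have := bw_le41 (wdeg W' x).
case: (boolP (x \in W)) => xW /=.
  have -> : x \in Z = false.
    by apply: contraTF xW => xZ; rewrite (disjointFr dZ xZ).
  by case: (x \in W') => /= h _ _ _; lia.
have -> : x \in W' = false by apply: contraNF xW; apply: (subsetP sW).
case: (boolP (x \in Z)) => [/hZ -> |_] /=; first by rewrite /=; lia.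
by move=> _ h1 /(_ isT h1) + h3; rewrite {1}h3 addKn !addn0.
Qed.

(** * Picking one pair *)

Definition step W v w := W :\: (v |: nbhd e v :|: (w |: nbhd e w)).

Lemma step_sub W v w : step W v w \subset W.
Proof. exact: subsetDl. Qed.

Lemma stepC W v w : step W v w = step W w v.
Proof. by rewrite /step setUC. Qed.

Lemma wdeg_step_l W v w : wdeg (step W v w) v = 0.
Proof.
apply/eqP; rewrite cards_eq0; apply/eqP/setP => y; rewrite !inE.
by case: (e v y); rewrite ?orbT ?andbF.
Qed.

Lemma wdeg_step_r W v w : wdeg (step W v w) w = 0.
Proof. by rewrite stepC wdeg_step_l. Qed.

Lemma in_newly_dominated W v w x :
  (x \in W :\: step W v w) =
  (x \in W) && [|| x == v, e v x, x == w | e w x].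
Proof. by rewrite !inE; case: (x \in W); rewrite ?andbF ?andbT ?negbK //= -orbA. Qed.

(** This is [s x] of the overview: it counts what [x] brings as partner of [v], and it bounds the
    degree left to [x] whatever the partner. *)
Definition outdeg W v x := #|(nbhd e x :&: W) :\: (v |: nbhd e v)|.

Lemma wdeg_step_outdeg W v w x : wdeg (step W v w) x <= outdeg W v x.
Proof.
apply/subset_leq_card/subsetP => y; rewrite !inE => /and3P[-> + ->].
by rewrite negb_or => /andP[-> _].
Qed.

Lemma wdeg_step_nbr W v w z : w \in W -> e w z ->
  wdeg (step W v w) z <= (wdeg W z).-1.
Proof.
move=> wW ewz; rewrite [wdeg W z](cardsD1 w) !inE esym ewz wW /=.
apply/subset_leq_card/subsetP => y; rewrite !inE => /and3P[-> + ->].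
by rewrite !negb_or => /andP[_ /andP[-> _]].
Qed.

Hypothesis eirr : irreflexive e.

(** The three groups on the left are disjoint. [v] is set aside because it may lie in [W] or
    outside, and its weight is counted separately. *)
Lemma sum_newly_dominated W v w (F : T -> nat) :
  w \in W -> e v w ->
  F w + \sum_(x in (nbhd e v :&: W) :\ w) F x
    + \sum_(x in (nbhd e w :&: W) :\: (v |: nbhd e v)) F x
  <= \sum_(x in (W :\: step W v w) :\ v) F x.
Proof.
move=> wW evw.
have nwv : w != v by apply: contraTneq evw => ->; rewrite eirr.
rewrite [leqRHS](big_setD1 w) /=; last by rewrite in_setD1 in_newly_dominated nwv wW eqxx !orbT.
rewrite -addnA leq_add2l [leqRHS](big_setID (nbhd e v)) /= leq_add //.
  apply/sum_nat_subset/subsetP => x; rewrite !inE => /and3P[-> evx ->] /=.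
  by rewrite evx !orbT /= !andbT; apply: contraTneq evx => ->; rewrite eirr.
apply/sum_nat_subset/subsetP => x; rewrite !inE negb_or.
move=> /and3P[/andP[-> /negbTE nvx] ewx ->]; rewrite nvx ewx !orbT /= !andbT.
by apply: contraTneq ewx => ->; rewrite eirr.
Qed.

(** * Weight lost by one pair *)

Hypothesis dmin : min_deg_ge e 4.

(** Minimum degree 4 guarantees edges that leave [W] and avoid [Z]; these are the edges paid at rate
    [D] in [phi_drop]. *)
Lemma blue_nbrs_ge W Z x d m : wdeg W x <= d -> #|nbhd e x :&: Z| <= m ->
  4 - d - m <= #|nbhd e x :\: W :\: Z|.
Proof.
have := dmin x; rewrite /deg -(cardsID W (nbhd e x)) -/(wdeg W x).
rewrite -(cardsID Z (nbhd e x :\: W)).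
have : #|(nbhd e x :\: W) :&: Z| <= #|nbhd e x :&: Z|.
  by apply/subset_leq_card/setSI/subsetDl.
by lia.
Qed.

(** Names call vertices of [W] white and the others blue. [v] and [w] lose 50 each; the other
    neighbours of [v] in [W] keep at most [bw (outdeg W v w)] by maximality of [w]; the neighbours
    of [w] beyond [N[v]] lose at least the edge to [w]. Each has at least [4 - wdeg W v] blue
    neighbours. *)
Lemma white_step W D v w :
  v \in W -> w \in W -> e v w -> steep W D ->
  (forall x, x \in W -> wdeg W x <= wdeg W v) ->
  (forall x, x \in W -> e v x -> outdeg W v x <= outdeg W v w) ->
  phi (step W v w) + (100 + 2 * (D * (4 - wdeg W v))
    + (wdeg W v).-1 * (50 - bw (outdeg W v w) + D * (4 - wdeg W v))
    + outdeg W v w * (50 - bw (wdeg W v).-1 + D * (4 - wdeg W v))) <= phi W.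
Proof.
move=> vW wW evw hD hk hs; set k := wdeg W v; set s := outdeg W v w.
have d0 : [disjoint (set0 : {set T}) & W] by rewrite -setI_eq0 set0I.
have := phi_drop (step_sub W v w) d0 _ hD; rewrite big_set0 addn0.
pose F x := 50 - bw (wdeg (step W v w) x) + D * #|nbhd e x :\: W :\: set0|.
move=> h.
have {}h : phi (step W v w) + \sum_(x in W :\: step W v w) F x <= phi W.
  by apply: h => z; rewrite inE.
apply: leq_trans h; rewrite leq_add2l (big_setD1 v) /=; last first.
  by rewrite in_newly_dominated vW eqxx.
have hF x j : x \in W -> wdeg (step W v w) x <= j ->
    50 - bw j + D * (4 - k) <= F x.
  move=> xW hj; apply: leq_add; first by apply/leq_sub2l/bw_mono.
  by rewrite leq_mul2l -(subn0 (4 - k)) blue_nbrs_ge ?orbT ?hk // setI0 cards0.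
have Fv : 50 + D * (4 - k) <= F v by apply: (hF v 0); rewrite ?wdeg_step_l.
have Fw : 50 + D * (4 - k) <= F w by apply: (hF w 0); rewrite ?wdeg_step_r.
have FA : k.-1 * (50 - bw s + D * (4 - k)) <= \sum_(x in (nbhd e v :&: W) :\ w) F x.
  apply: sum_nat_ge_card => [|x].
    by rewrite /k /wdeg (cardsD1 w) !inE evw wW.
  rewrite !inE => /and3P[_ evx xW]; apply: hF => //.
  exact: leq_trans (wdeg_step_outdeg _ _ _ _) (hs _ xW evx).
have FB : s * (50 - bw k.-1 + D * (4 - k))
    <= \sum_(x in (nbhd e w :&: W) :\: (v |: nbhd e v)) F x.
  apply: sum_nat_ge_card => // x.
  rewrite !inE => /and3P[_ ewx xW]; apply: hF => //.
  apply: leq_trans (wdeg_step_nbr _ wW ewx) _.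
  by have := hk x xW; rewrite -/k; lia.
by have := sum_newly_dominated F wW evw; lia.
Qed.

(** Here [v] gives up its whole weight, so edges to it must not be paid again: neighbours of [v] are
    only sure of [3 - r] other blue neighbours, vertices beyond [N[v]] of [4 - r]. *)
Lemma blue_step W D r v w :
  v \notin W -> w \in W -> e v w -> steep W D ->
  (forall x, x \in W -> wdeg W x <= r) ->
  (forall x, x \in W -> e v x -> outdeg W v x <= outdeg W v w) ->
  phi (step W v w) + (bw (wdeg W v) + (50 + D * (3 - r))
    + (wdeg W v).-1 * (50 - bw (outdeg W v w) + D * (3 - r))
    + outdeg W v w * (50 - bw r.-1 + D * (4 - r))) <= phi W.
Proof.
move=> vW wW evw hD hk hs; set k := wdeg W v; set s := outdeg W v w.
have d0 : [disjoint [set v] & W] by rewrite disjoints1.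
have := phi_drop (step_sub W v w) d0 _ hD; rewrite big_set1 -/k.
pose F x := 50 - bw (wdeg (step W v w) x) + D * #|nbhd e x :\: W :\: [set v]|.
move=> h.
have {}h : phi (step W v w) + bw k + \sum_(x in W :\: step W v w) F x <= phi W.
  by apply: h => z /set1P ->; rewrite wdeg_step_l.
apply: leq_trans h; rewrite -!addnA !leq_add2l.
apply: leq_trans (sum_nat_subset _ (subsetDl _ [set v])).
apply: leq_trans (sum_newly_dominated F wW evw).
have hF x j : x \in W -> wdeg (step W v w) x <= j ->
    50 - bw j + D * (3 - r) <= F x.
  move=> xW hj; apply: leq_add; first by apply/leq_sub2l/bw_mono.
  rewrite leq_mul2l; apply/orP; right.
  have -> : 3 - r = 4 - r - 1 by lia.
  apply: blue_nbrs_ge; rewrite ?hk //.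
  by apply: leq_trans (subset_leq_card (subsetIr _ _)) _; rewrite cards1.
have Fw : 50 + D * (3 - r) <= F w by apply: (hF w 0); rewrite ?wdeg_step_r.
have FA : k.-1 * (50 - bw s + D * (3 - r)) <= \sum_(x in (nbhd e v :&: W) :\ w) F x.
  apply: sum_nat_ge_card => [|x].
    by rewrite /k /wdeg (cardsD1 w) !inE evw wW.
  rewrite !inE => /and3P[_ evx xW]; apply: hF => //.
  exact: leq_trans (wdeg_step_outdeg _ _ _ _) (hs _ xW evx).
have FB : s * (50 - bw r.-1 + D * (4 - r))
    <= \sum_(x in (nbhd e w :&: W) :\: (v |: nbhd e v)) F x.
  apply: sum_nat_ge_card => // x.
  rewrite !inE negb_or => /and3P[/andP[_ nvx] ewx xW]; apply: leq_add.
    apply/leq_sub2l/bw_mono; apply: leq_trans (wdeg_step_nbr _ wW ewx) _.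
    by have := hk x xW; lia.
  rewrite leq_mul2l -(subn0 (4 - r)) blue_nbrs_ge ?orbT ?hk //.
  rewrite leqn0 cards_eq0; apply/eqP/setP => y; rewrite !inE.
  by apply/negbTE/negP => /andP[exy /eqP yv]; rewrite -yv esym exy in nvx.
by lia.
Qed.

(** * Single pairs while some degree into [W] is large *)

Lemma exists_outdeg_max W v : 0 < wdeg W v ->
  exists w, [/\ w \in W, e v w &
    forall x, x \in W -> e v x -> outdeg W v x <= outdeg W v w].
Proof.
rewrite card_gt0 => /set0Pn[w0 hw0].
case: (arg_maxnP (outdeg W v) hw0) => w /setIP[evw wW] hw; rewrite inE in evw.
by exists w; split=> // x xW evx; apply: hw; apply/setIP; rewrite inE.
Qed.

Lemma outdeg_le W v w : outdeg W v w <= wdeg W w.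
Proof. exact/subset_leq_card/subsetDl. Qed.

Lemma outdeg_lt W v w : v \in W -> e v w -> outdeg W v w <= (wdeg W w).-1.
Proof.
move=> vW evw; rewrite [wdeg W w](cardsD1 v) !inE esym evw vW /=.
by apply/subset_leq_card/setDS/subsetP => x /set1P ->; rewrite !inE eqxx.
Qed.

Definition one_step_drop W := exists v w,
  [/\ w \in W, e v w & phi (step W v w) + 170 <= phi W].

(** Outside degrees are still unbounded, but slope 0 suffices: the bound never falls below 172. *)
Lemma drop_white4 W v :
  v \in W -> 4 <= wdeg W v -> (forall x, x \in W -> wdeg W x <= wdeg W v) ->
  one_step_drop W.
Proof.
move=> vW k4 hk; have [|w [wW evw hw]] := @exists_outdeg_max W v; first by lia.
exists v, w; split=> //.
have := white_step vW wW evw (@steep0 W) hk hw; have := outdeg_lt vW evw.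
have := hk w wW; move: (wdeg W v) (outdeg W v w) k4 => k s k4 hkw hs.
have {hkw} {}hs : s <= k.-1 by lia.
case: k k4 hs => [|[|[|[|[|k]]]]] //= _; case: s => [|[|[|[|s]]]] //=; lia.
Qed.

Lemma drop_white23 W v :
  v \in W -> 2 <= wdeg W v <= 3 -> (forall x, x \in W -> wdeg W x <= wdeg W v) ->
  (forall u, u \notin W -> wdeg W u <= 3) -> one_step_drop W.
Proof.
move=> vW k4 hk hb; have [|w [wW evw hw]] := @exists_outdeg_max W v; first by lia.
exists v, w; split=> //.
have := white_step vW wW evw (steep4 hb) hk hw; have := outdeg_lt vW evw.
have := hk w wW; move: (wdeg W v) (outdeg W v w) k4 => k s k4 hkw hs.
have {hkw} {}hs : s <= k.-1 by lia.
by case: k k4 hs => [|[|[|[|k]]]] //= _; case: s => [|[|[|[|s]]]] //=; lia.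
Qed.

Lemma drop_blue5 W v :
  v \notin W -> 5 <= wdeg W v -> (forall x, x \in W -> wdeg W x <= 3) ->
  one_step_drop W.
Proof.
move=> vW k4 hk; have [|w [wW evw hw]] := @exists_outdeg_max W v; first by lia.
exists v, w; split=> //.
have := blue_step vW wW evw (@steep0 W) hk hw; have := outdeg_le W v w.
have := hk w wW; move: (wdeg W v) (outdeg W v w) k4 => k s k4 hkw hs.
have {hkw} {}hs : s <= 3 by lia.
case: k k4 => [|[|[|[|[|k]]]]] //= _; case: s hs => [|[|[|[|s]]]] //=; lia.
Qed.

(** The tight case is [outdeg W v w = 1]: [41 + 50 + 3 * 20 + (16 + 3) = 170]. Slope 0 would give
    only 167. *)
Lemma drop_blue4 W v :
  v \notin W -> wdeg W v = 4 -> (forall x, x \in W -> wdeg W x <= 3) ->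
  (forall u, u \notin W -> wdeg W u <= 4) -> one_step_drop W.
Proof.
move=> vW k4 hk hb; have [|w [wW evw hw]] := @exists_outdeg_max W v; first by lia.
exists v, w; split=> //.
have := blue_step vW wW evw (steep3 hb) hk hw; have := outdeg_le W v w.
have := hk w wW; rewrite k4; move: (outdeg W v w) => s hkw hs.
have {hkw} {}hs : s <= 3 by lia.
by case: s hs => [|[|[|[|s]]]] //=; lia.
Qed.

Lemma drop_blue3 W v :
  v \notin W -> wdeg W v = 3 -> (forall x, x \in W -> wdeg W x <= 1) ->
  (forall u, u \notin W -> wdeg W u <= 3) -> one_step_drop W.
Proof.
move=> vW k4 hk hb; have [|w [wW evw hw]] := @exists_outdeg_max W v; first by lia.
exists v, w; split=> //.
have := blue_step vW wW evw (steep4 hb) hk hw; have := outdeg_le W v w.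
have := hk w wW; rewrite k4; move: (outdeg W v w) => s hkw hs.
have {hkw} {}hs : s <= 1 by lia.
by case: s hs => [|[|[|[|s]]]] //=; lia.
Qed.

(** Without a vertex of [W] beyond [N[v]] the bound would be only 150; with one it is 182. *)
Lemma drop_blue2_outdeg W v x :
  v \notin W -> wdeg W v = 2 -> x \in W -> e v x -> 0 < outdeg W v x ->
  (forall x, x \in W -> wdeg W x <= 1) ->
  (forall u, u \notin W -> wdeg W u <= 2) -> one_step_drop W.
Proof.
move=> vW k4 xW evx sx hk hb.
have [|w [wW evw hw]] := @exists_outdeg_max W v; first by lia.
have {}hb u : u \notin W -> wdeg W u <= 3 by move/hb; lia.
exists v, w; split=> //.
have := blue_step vW wW evw (steep4 hb) hk hw; have := outdeg_le W v w.
have := hw x xW evx.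
have := hk w wW; rewrite k4; move: (outdeg W v w) => s hkw hx hs.
have {hkw} {}hs : s = 1 by lia.
by rewrite hs /=; lia.
Qed.

(** * Edges inside a sparse [W] *)

Lemma wdeg_ge1 W u x : x \in W -> e u x -> 0 < wdeg W u.
Proof. by move=> xW eux; apply/card_gt0P; exists x; rewrite !inE eux. Qed.

Lemma wdeg_ge2 W u x y :
  x \in W -> e u x -> y \in W -> e u y -> x != y -> 1 < wdeg W u.
Proof.
move=> xW eux yW euy nxy; apply/card_gt1P.
by exists x, y; rewrite !inE eux euy.
Qed.

Lemma wdeg_ge3 W u x y z :
  x \in W -> e u x -> y \in W -> e u y -> z \in W -> e u z ->
  x != y -> y != z -> z != x -> 2 < wdeg W u.
Proof.
move=> xW eux yW euy zW euz nxy nyz nzx; apply/card_gt2P.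
by exists x, y, z; rewrite !inE eux euy euz.
Qed.

(** Let [y] be the neighbour of [x] in [W]. A blue neighbour of [x] that sees a second vertex of [W]
    other than [y] has [y] beyond its neighbourhood, and the previous lemma applies. Otherwise the
    pair [x], [y] empties the at least three blue neighbours of [x], removing [100 + 3 * 30]. *)
Lemma drop_white1 W x :
  x \in W -> wdeg W x = 1 -> (forall y, y \in W -> wdeg W y <= 1) ->
  (forall u, u \notin W -> wdeg W u <= 2) -> one_step_drop W.
Proof.
move=> xW kx hk hb.
have /card_gt0P[y /setIP[exy yW]] : 0 < wdeg W x by rewrite kx.
rewrite inE in exy.
have nyx : y != x by apply: contraTneq exy => ->; rewrite eirr.
have [/existsP[u /and4P[uW exu /eqP ku nuy]]|/existsPn hu] :=
    boolP [exists u, [&& u \notin W, e x u, wdeg W u == 2 & ~~ e u y]].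
  apply: (drop_blue2_outdeg uW ku xW) => //; first by rewrite esym.
  apply/card_gt0P; exists y; rewrite !inE negb_or nuy exy yW !andbT.
  by apply: contraTneq yW => ->.
exists x, y; split=> //.
pose Z := nbhd e x :\: W.
have dZ : [disjoint Z & W] by rewrite disjoint_sym disjoints_subset setCD subsetUr.
have hZ z : z \in Z -> wdeg (step W x y) z = 0.
  rewrite !inE => /andP[zW exz].
  have := hu z; rewrite zW exz /= negb_and negbK => hzy.
  have := wdeg_step_nbr y xW exz; rewrite stepC => h1.
  have hz := hb z zW.
  case/orP: hzy => [/eqP nk|ezy]; first by lia.
  rewrite (wdeg_split z (step_sub W x y)) in hz.
  have : 1 < wdeg (W :\: step W x y) z.
    apply: (@wdeg_ge2 _ _ x y) => //; rewrite ?in_newly_dominated ?xW ?yW ?eqxx ?exy ?orbT //.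
    - by rewrite esym.
    - by rewrite eq_sym.
  by lia.
have := phi_drop (step_sub W x y) dZ hZ (@steep0 W).
have : 3 * 30 <= \sum_(z in Z) bw (wdeg W z).
  apply: sum_nat_ge_card => [|z].
    have := dmin x; rewrite /deg -(cardsID W (nbhd e x)) -/(wdeg W x) kx /Z; lia.
  rewrite !inE => /andP[zW exz]; apply: (@bw_mono 1).
  by apply: (wdeg_ge1 xW); rewrite esym.
have : 2 * 50 <= \sum_(z in W :\: step W x y)
    (50 - bw (wdeg (step W x y) z) + 0 * #|nbhd e z :\: W :\: Z|).
  apply: leq_trans (sum_nat_subset (A := [set x; y]) _ _); last first.
    apply/subsetP => z /set2P[] ->; rewrite in_newly_dominated ?xW ?yW ?eqxx ?orbT //.
  apply: sum_nat_ge_card; first by rewrite cards2 eq_sym nyx.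
  by move=> z /set2P[] ->; rewrite ?wdeg_step_l ?wdeg_step_r.
by lia.
Qed.

(** * Isolated vertices and independent [W] *)

Lemma wdeg0_nbr W x u : wdeg W x = 0 -> e x u -> u \notin W.
Proof.
move=> kx exu; apply: contra_eqN kx => uW.
by rewrite -lt0n (wdeg_ge1 uW).
Qed.

Lemma drop_private W x :
  x \in W -> wdeg W x = 0 -> (forall u, e x u -> wdeg W u = 1) -> one_step_drop W.
Proof.
move=> xW kx hu.
(* The partner of [x] is arbitrary: dominating [x] already empties all its neighbours, for
   [50 + 4 * 30 = 170]. *)
have /card_gt0P[v] : 0 < #|nbhd e x| by apply: leq_trans (dmin x).
rewrite inE => exv; exists v, x; split; rewrite ?[e v x]esym //.
have hZ z : z \in nbhd e x -> wdeg (step W v x) z = 0.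
  rewrite inE => exz; have := wdeg_step_nbr v xW exz.
  by rewrite (hu z exz); lia.
have dZ : [disjoint nbhd e x & W].
  by rewrite disjoint_subset; apply/subsetP => z; rewrite !inE; apply: wdeg0_nbr.
have := phi_drop (step_sub W v x) dZ hZ (@steep0 W).
have : 4 * 30 <= \sum_(z in nbhd e x) bw (wdeg W z).
  by apply: sum_nat_ge_card => [|z]; [apply: dmin | rewrite inE => /hu ->].
have xX : x \in W :\: step W v x by rewrite in_newly_dominated xW eqxx !orbT.
rewrite (big_setD1 x xX) /=.
by rewrite wdeg_step_r /=; lia.
Qed.

Definition indep W := forall x, x \in W -> wdeg W x = 0.

Lemma indep_blue_nbrs W Z x m : indep W -> x \in W -> #|nbhd e x :&: Z| <= m ->
  4 - m <= #|nbhd e x :\: W :\: Z|.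
Proof. by move=> iW xW hZ; rewrite -(subn0 4) blue_nbrs_ge ?iW. Qed.

(** The pair [v], [x] dominates all that [u] sees in [W], so [v] and [u] lose everything. The loss
    is at least [34 + 30 + 2 * (50 + 4 * 2) = 180], as two of four blue neighbours may be [v] and
    [u]. *)
Lemma drop_nested W v u x :
  indep W -> (forall z, z \notin W -> wdeg W z <= 2) ->
  v \notin W -> wdeg W v = 2 -> x \in W -> e v x -> e u x -> u != v ->
  nbhd e u :&: W \subset nbhd e v -> one_step_drop W.
Proof.
move=> iW hb vW kv xW evx eux nuv suv.
have uW : u \notin W by apply: (wdeg0_nbr (iW x xW)); rewrite esym.
exists v, x; split=> //.
have h4 : steep W 4 by apply: steep4 => z /hb; lia.
have dZ : [disjoint [set v; u] & W].
  by rewrite disjoint_subset; apply/subsetP => z /set2P[] ->.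
have hZ z : z \in [set v; u] -> wdeg (step W v x) z = 0.
  case/set2P => ->; first by rewrite wdeg_step_l.
  apply/eqP; rewrite cards_eq0 -subset0; apply/subsetP => y.
  rewrite !inE => /and3P[euy + yW].
  by have /subsetP/(_ y) := suv; rewrite !inE euy yW => ->; rewrite ?orbT.
have := phi_drop (step_sub W v x) dZ hZ h4.
rewrite big_setU1 ?inE 1?eq_sym // big_set1 kv.
have : 30 <= bw (wdeg W u) by apply: (@bw_mono 1); apply: wdeg_ge1 xW eux.
have : 2 * (50 + 4 * 2) <= \sum_(z in W :\: step W v x)
    (50 - bw (wdeg (step W v x) z) + 4 * #|nbhd e z :\: W :\: [set v; u]|).
  apply: leq_trans (sum_nat_subset (A := nbhd e v :&: W) _ _); last first.
    apply/subsetP => z; rewrite in_newly_dominated !inE => /andP[-> ->].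
    by rewrite orbT.
  apply: sum_nat_ge_card; first by rewrite -kv.
  move=> z; rewrite inE => /andP[_ zW]; apply: leq_add.
    by have := wdeg_sub z (step_sub W v x); rewrite (iW z zW) leqn0 => /eqP ->.
  rewrite leq_mul2l; apply: (@indep_blue_nbrs W _ z 2) => //.
  by apply: leq_trans (subset_leq_card (subsetIr _ _)) _; rewrite cards2; case: (v != u).
by rewrite /=; lia.
Qed.

Definition two_step_drop W := exists v w v' w',
  [/\ w \in W, e v w, w' \in step W v w, e v' w' &
    phi (step (step W v w) v' w') + 340 <= phi W].

(* The first pair leaves [u] with the single neighbour [x3] in [W], so that
   the second pair also removes the whole weight of [u]: 158 + 184 >= 340. *)
Lemma drop_two_step W v x1 u x3 a y :
  indep W -> (forall z, z \notin W -> wdeg W z <= 2) ->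
  v \notin W -> wdeg W v = 2 -> x1 \in W -> e v x1 ->
  e u x1 -> x3 \in W -> e u x3 -> ~~ e v x3 ->
  e a x3 -> a != u -> y \in W -> e a y -> ~~ e u y -> ~~ e v y ->
  two_step_drop W.
Proof.
move=> iW hb vW kv x1W evx1 eux1 x3W eux3 nvx3 eax3 nau yW eay nuy nvy.
have uW : u \notin W by apply: (wdeg0_nbr (iW _ x1W)); rewrite esym.
have aW : a \notin W by apply: (wdeg0_nbr (iW _ x3W)); rewrite esym.
have n31 : x3 != x1 by apply: contraNneq nvx3 => ->.
have ny1 : y != x1 by apply: contraNneq nuy => ->.
have ny3 : x3 != y by apply: contraNneq nuy => <-.
have inW1 z : z \in W -> ~~ e v z -> z != x1 -> z \in step W v x1.
  move=> zW nvz nz1; rewrite !inE zW andbT (negbTE nvz) (negbTE nz1) orbF /=.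
  rewrite negb_or; apply/andP; split; first by apply: contraNneq vW => <-.
  by apply: contraTN zW => /(wdeg0_nbr (iW _ x1W)).
have h4 : steep W 4 by apply: steep4 => z /hb /leqW.
(* Both neighbours of [v] in [W] go, each with three further blue neighbours:
   [34 + 2 * (50 + 4 * 3) = 158]. *)
have drop1 : phi (step W v x1) + 158 <= phi W.
  have h0 x : x \in W -> outdeg W v x = 0.
    by move=> xW; apply/eqP; rewrite -leqn0 -(iW x xW) outdeg_le.
  have := @blue_step W 4 0 v x1 vW x1W evx1 h4.
  rewrite kv h0 //= => h; apply: leq_trans (h _ _); first by clear; lia.
    by move=> x /iW ->.
  by move=> x xW _; rewrite h0.
set W1 := step W v x1 in drop1 *.
have sW1 : W1 \subset W := step_sub _ _ _.
have x3W1 : x3 \in W1 by apply: inW1.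
have yW1 : y \in W1 by apply: inW1.
have iW1 : indep W1.
  by move=> z /(subsetP sW1) /iW kz; apply/eqP; rewrite -leqn0 -kz wdeg_sub.
have hb1 z : z \notin W1 -> wdeg W1 z <= 2.
  move=> _; apply: leq_trans (wdeg_sub z sW1) _.
  by case: (boolP (z \in W)) => [/iW ->|/hb].
have h41 : steep W1 4 by apply: steep4 => z /hb1 /leqW.
have ka : wdeg W1 a = 2.
  apply/eqP; rewrite eqn_leq (wdeg_ge2 x3W1 eax3 yW1 eay ny3) andbT.
  by apply: leq_trans (wdeg_sub a sW1) (hb a aW).
have ku : wdeg W1 u = 1.
  apply/eqP; rewrite eqn_leq (wdeg_ge1 x3W1 eux3) andbT.
  have := wdeg_step_nbr v x1W (_ : e x1 u); rewrite -/W1 esym => /(_ eux1).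
  by have := hb u uW; clear; lia.
exists v, x1, a, x3; split=> //; rewrite -/W1.
have dZ : [disjoint [set a; u] & W1].
  rewrite disjoint_subset; apply/subsetP => z /set2P[] ->; rewrite inE.
    by apply: contra aW; apply: (subsetP sW1).
  by apply: contra uW; apply: (subsetP sW1).
have hZ z : z \in [set a; u] -> wdeg (step W1 a x3) z = 0.
  case/set2P => ->; first by rewrite wdeg_step_l.
  have := wdeg_step_nbr a x3W1 (_ : e x3 u); rewrite esym => /(_ eux3).
  by rewrite ku leqn0 => /eqP.
have := phi_drop (step_sub W1 a x3) dZ hZ h41.
rewrite big_setU1 ?inE // big_set1 ka ku.
have y2 : y \in (W1 :\: step W1 a x3) :\ x3.
  by rewrite in_setD1 in_newly_dominated yW1 eay eq_sym ny3 orbT.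
rewrite (big_setD1 x3) /=; last by rewrite in_newly_dominated x3W1 eqxx !orbT.
rewrite (big_setD1 y) //= wdeg_step_r.
have -> : wdeg (step W1 a x3) y = 0.
  by apply/eqP; rewrite -leqn0 -(iW1 y yW1) wdeg_sub ?step_sub.
(* [x3] sees both [a] and [u], while [y] misses [u]: the second pair removes [34 + 30 + (50 + 4 * 2)
   + (50 + 4 * 3) = 184]. *)
have : 2 <= #|nbhd e x3 :\: W1 :\: [set a; u]|.
  apply: (@indep_blue_nbrs W1 _ x3 2) => //.
  by apply: leq_trans (subset_leq_card (subsetIr _ _)) _; rewrite cards2; case: (a != u).
have : 3 <= #|nbhd e y :\: W1 :\: [set a; u]|.
  apply: (@indep_blue_nbrs W1 _ y 1) => //; rewrite -(cards1 a).
  apply/subset_leq_card/subsetP => z; rewrite !inE => /andP[eyz /orP[//|/eqP zu]].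
  by rewrite -zu esym eyz in nuy.
by move: drop1; clear; rewrite /=; lia.
Qed.

(** Without private or nested neighbourhoods, a path [v], [x1], [u], [x3] extends through a
    neighbour of [x3] to a vertex of [W] missed by [u]. Two choices of that neighbour ensure that
    one such vertex is also missed by [v]. *)
Lemma drop_indep W x1 :
  x1 \in W -> indep W -> (forall z, z \notin W -> wdeg W z <= 2) ->
  one_step_drop W \/ two_step_drop W.
Proof.
move=> x1W iW hb.
have blue x u : x \in W -> e u x -> u \notin W.
  by move=> xW eux; apply: (wdeg0_nbr (iW x xW)); rewrite esym.
have [/forallP hall|/forallPn[v]] := boolP [forall u, e x1 u ==> (wdeg W u == 1)].
  by left; apply: (drop_private x1W (iW _ x1W)) => u exu; apply/eqP/(implyP (hall u)).
rewrite negb_imply => /andP[ex1v kv].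
have evx1 : e v x1 by rewrite esym.
have vW := blue _ _ x1W evx1.
have {}kv : wdeg W v = 2 by have := hb v vW; have := wdeg_ge1 x1W evx1; move: kv; clear; lia.
have [/existsP[p /existsP[q /existsP[x /and5P[xW epx eqx nqp /andP[/eqP kp sqp]]]]]|no] :=
    boolP [exists p, exists q, exists x, [&& x \in W, e p x, e q x, q != p,
      wdeg W p == 2 & nbhd e q :&: W \subset nbhd e p]].
  by left; apply: (drop_nested iW hb (blue _ _ xW epx) kp xW epx eqx).
right.
have new p q x : wdeg W p = 2 -> x \in W -> e p x -> e q x -> q != p ->
    exists y, [/\ y \in W, e q y & ~~ e p y].
  move=> kp xW epx eqx nqp; have : ~~ (nbhd e q :&: W \subset nbhd e p).
    apply: contra no => sqp; apply/existsP; exists p; apply/existsP; exists q.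
    by apply/existsP; exists x; apply/and5P; split=> //; rewrite kp sqp eqxx.
  by case/subsetPn => y; rewrite !inE => /andP[eqy yW] npy; exists y.
have /card_gt0P[u] : 0 < #|nbhd e x1 :\ v|.
  by have := dmin x1; rewrite /deg (cardsD1 v) inE ex1v; clear; lia.
rewrite !inE => /andP[nuv ex1u]; have eux1 : e u x1 by rewrite esym.
have [x3 [x3W eux3 nvx3]] := new v u x1 kv x1W evx1 eux1 nuv.
have n13 : x1 != x3 by apply: contraNneq nvx3 => <-.
have ku : wdeg W u = 2.
  have := hb u (blue _ _ x1W eux1).
  by have := wdeg_ge2 x1W eux1 x3W eux3 n13; clear; lia.
have /card_gt1P[a [b []]] : 1 < #|nbhd e x3 :\ u|.
  by have := dmin x3; rewrite /deg (cardsD1 u) inE esym eux3; clear; lia.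
rewrite !inE => /andP[nau ex3a] /andP[nbu ex3b] nab.
have eax3 : e a x3 by rewrite esym.
have ebx3 : e b x3 by rewrite esym.
have [ya [yaW eaya nuya]] := new u a x3 ku x3W eux3 eax3 nau.
have [yb [ybW ebyb nuyb]] := new u b x3 ku x3W eux3 ebx3 nbu.
have two := drop_two_step iW hb vW kv x1W evx1 eux1 x3W eux3 nvx3.
have [evya|/(two _ _ eax3 nau yaW eaya nuya)//] := boolP (e v ya).
have [evyb|/(two _ _ ebx3 nbu ybW ebyb nuyb)//] := boolP (e v yb).
(* Since [v] sees only one vertex of [W] besides [x1], [ya] and [yb] coincide. Then [a] already sees
   [x3] and [ya], and [b], which sees both, needs a third neighbour in [W]. *)
exfalso.
have ny1 z : ~~ e u z -> x1 != z by move=> nuz; apply: contraNneq nuz => <-.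
have ny3 z : ~~ e u z -> x3 != z by move=> nuz; apply: contraNneq nuz => <-.
have eab : ya = yb.
  apply/eqP/negPn/negP => nyab; have := hb v vW; rewrite leqNgt => /negP; apply.
  by apply: (wdeg_ge3 x1W evx1 yaW evya ybW evyb _ nyab); rewrite ?[yb == x1]eq_sym ny1.
subst yb.
have ka : wdeg W a = 2.
  have := hb a (blue _ _ x3W eax3).
  by have := wdeg_ge2 x3W eax3 yaW eaya (ny3 _ nuya); clear; lia.
have nba : b != a by rewrite eq_sym.
have [z [zW ebz naz]] := new a b x3 ka x3W eax3 ebx3 nba.
have := hb b (blue _ _ x3W ebx3); rewrite leqNgt => /negP; apply.
apply: (wdeg_ge3 x3W ebx3 yaW ebyb zW ebz) => //; first exact: ny3.
  by apply: contraNneq naz => <-.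
by apply: contraNneq naz => ->.
Qed.

(** The cases are ordered so that each failed one supplies the degree bound, and hence the slope,
    used by the next. *)
Lemma exists_drop W : W != set0 -> one_step_drop W \/ two_step_drop W.
Proof.
case/set0Pn => v0 hv0; have [v vW hk] := arg_maxnP (wdeg W) hv0.
have [k4|k3] := leqP 4 (wdeg W v); first by left; apply: (drop_white4 vW k4 hk).
have hw3 x : x \in W -> wdeg W x <= 3 by move/hk => h; apply: leq_trans h k3.
have [/existsP[u /andP[uW ku]]|/existsPn h5] := boolP [exists u, (u \notin W) && (4 < wdeg W u)].
  by left; apply: (drop_blue5 uW).
have {}h5 u : u \notin W -> wdeg W u <= 4.
  by move=> uW; have := h5 u; rewrite uW -leqNgt.
have [/existsP[u /andP[uW ku]]|/existsPn h4] := boolP [exists u, (u \notin W) && (3 < wdeg W u)].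
  left; apply: (drop_blue4 uW) => //.
  by apply/eqP; rewrite eqn_leq h5.
have {h5} h4 u : u \notin W -> wdeg W u <= 3.
  by move=> uW; have := h4 u; rewrite uW -leqNgt.
have [k2|k1] := leqP 2 (wdeg W v).
  by left; apply: (drop_white23 vW) => //; rewrite k2.
have hw1 x : x \in W -> wdeg W x <= 1 by move/hk => h; apply: leq_trans h k1.
have [/existsP[u /andP[uW ku]]|/existsPn h3] := boolP [exists u, (u \notin W) && (2 < wdeg W u)].
  left; apply: (drop_blue3 uW) => //.
  by apply/eqP; rewrite eqn_leq h4.
have {h4} h3 u : u \notin W -> wdeg W u <= 2.
  by move=> uW; have := h3 u; rewrite uW -leqNgt.
have [kv|kv] := posnP (wdeg W v).
  apply: (drop_indep vW) => // x /hk; rewrite [wdeg W v]kv => h.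
  by apply/eqP; rewrite -leqn0.
by left; apply: (drop_white1 vW) => //; apply/eqP; rewrite eqn_leq hw1.
Qed.

(** * Assembling the pairs into a matching *)

Definition closed_nbhd (A : {set T}) := [set x | (x \in A) || [exists y in A, e x y]].

(** Confining the pairs to the closed neighbourhood of [W] keeps them disjoint from pairs picked
    earlier, whose ends have no neighbour left in [W]. *)
Definition paired_cover W (M : {set {set T}}) :=
  [/\ forall m, m \in M -> exists x y, m = [set x; y] /\ e x y,
      trivIset M, cover M \subset closed_nbhd W & W \subset closed_nbhd (cover M)].

Lemma closed_nbhdS (A B : {set T}) : A \subset B -> closed_nbhd A \subset closed_nbhd B.
Proof.
move=> /subsetP sAB; apply/subsetP => x; rewrite !inE => /orP[/sAB ->//|].
by case/existsP => y /andP[/sAB yB exy]; apply/orP; right; apply/existsP; exists y; rewrite yB.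
Qed.

Lemma cover_setU1 (A : {set T}) (M : {set {set T}}) : cover (A |: M) = A :|: cover M.
Proof. by rewrite /cover bigcup_setU big_set1. Qed.

(* [v] and [w] lie outside the closed neighbourhood of what remains to be
   dominated, which is where the later pairs live. *)
Lemma paired_cover_step W v w M :
  w \in W -> e v w -> paired_cover (step W v w) M ->
  paired_cover W ([set v; w] |: M) /\ [set v; w] \notin M.
Proof.
move=> wW evw [hM tM sM dM].
have notin x : (x == v) || (x == w) -> x \notin closed_nbhd (step W v w).
  move=> hx; rewrite inE negb_or; apply/andP; split.
    by rewrite !inE; case/orP: hx => ->; rewrite ?orbT.
  apply/negP => /existsP[y /andP[+ exy]]; rewrite !inE => /andP[+ _].
  by case/orP: hx exy => /eqP -> ->; rewrite ?orbT.
have disj B : B \in M -> [disjoint [set v; w] & B].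
  move=> BM; rewrite disjoint_subset; apply/subsetP => x; rewrite !inE => /notin.
  apply: contra => xB; apply: (subsetP sM).
  by apply/bigcupP; exists B.
(* With no empty member in [M], disjointness makes the new pair a new member, so sizes add up. *)
have n0 : set0 \notin M.
  by apply/negP => /hM[x [y [/setP/(_ x)]]]; rewrite !inE eqxx.
have [tM' nM] := trivIsetU1 disj tM n0.
split=> //; split=> //.
- by move=> m /setU1P[->|/hM//]; exists v, w.
- rewrite cover_setU1 subUset; apply/andP; split; last first.
    by apply: subset_trans sM (closed_nbhdS (step_sub W v w)).
  apply/subsetP => x /set2P[] ->; rewrite !inE ?wW //.
  by apply/orP; right; apply/existsP; exists w; rewrite wW.
rewrite cover_setU1; apply/subsetP => x xW.
have [xs|] := boolP (x \in step W v w).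
  by apply: (subsetP (closed_nbhdS (subsetUr _ _))); apply: (subsetP dM).
move=> nxs; have : x \in W :\: step W v w by rewrite inE nxs.
rewrite in_newly_dominated xW /= => hx.
apply: (subsetP (closed_nbhdS (subsetUl _ _))); rewrite !inE.
case/or4P: hx => [->//|evx|->|ewx]; rewrite ?orbT //; apply/orP; right; apply/existsP.
  by exists v; rewrite !inE eqxx esym.
by exists w; rewrite !inE eqxx orbT esym.
Qed.

(** Strong induction on the size of [W], as two pairs may be picked at once; both kinds of reduction
    pay 170 per pair. *)
Lemma exists_paired_cover W : exists M, paired_cover W M /\ 170 * #|M| <= phi W.
Proof.
have [n] := ubnP #|W|; elim: n W => // n IH W; rewrite ltnS => hn.
have lt_step W' v w : w \in W' -> #|step W' v w| < #|W'|.
  move=> wW; apply: proper_card; rewrite properE step_sub; apply/subsetPn.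
  by exists w; rewrite // !inE eqxx orbT.
have [->|/exists_drop[]] := eqVneq W set0.
- exists set0; split; last by rewrite cards0 muln0.
  split; rewrite ?sub0set //; first by move=> m; rewrite inE.
    by apply/trivIsetP => A B; rewrite inE.
  by rewrite /cover big_set0 sub0set.
- move=> [v [w [wW evw hphi]]].
  have [|M [hM leM]] := IH (step W v w); first exact: leq_trans (lt_step _ v _ wW) hn.
  have [hM' nM] := paired_cover_step wW evw hM.
  by exists ([set v; w] |: M); split=> //; rewrite cardsU1 nM; move: leM hphi; clear; lia.
move=> [v [w [v' [w' [wW evw wW' evw' hphi]]]]].
have [|M [hM leM]] := IH (step (step W v w) v' w').
  exact: leq_trans (lt_step _ v' _ wW') (ltnW (leq_trans (lt_step _ v _ wW) hn)).
have [hM' nM'] := paired_cover_step wW' evw' hM.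
have [hM'' nM''] := paired_cover_step wW evw hM'.
exists ([set v; w] |: ([set v'; w'] |: M)); split=> //.
by rewrite cardsU1 nM'' cardsU1 nM'; move: leM hphi; clear; lia.
Qed.

Lemma phi_setT : phi setT = 50 * #|T|.
Proof.
rewrite /phi (eq_bigr (fun=> 50)) => [|x _]; last by rewrite inE.
by rewrite sum_nat_const mulnC.
Qed.

Lemma paired_cover_setT M :
  paired_cover setT M -> paired_dominating e (cover M).
Proof.
case=> hM tM _ dM; apply/andP; split.
  by apply/forallP => x; have := subsetP dM x (in_setT x); rewrite inE.
apply/existsP; exists M; apply/andP; split=> //; apply/andP; split=> //.
apply/forallP => m; apply/implyP => mM; have [x [y [Em exy]]] := hM m mM.
apply/existsP; exists x; apply/existsP; exists y; rewrite -Em eqxx exy /=.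
by apply/andP; split; apply/bigcupP; exists m; rewrite // Em !inE eqxx ?orbT.
Qed.

Lemma card_paired_cover W M : paired_cover W M -> #|cover M| <= 2 * #|M|.
Proof.
case=> hM _ _ _; apply: leq_trans (leq_card_cover M) _.
rewrite mulnC -sum_nat_const; apply: leq_sum => m /hM[x [y [-> _]]].
by rewrite cards2; case: (x != y).
Qed.

End Potential.

(** * The bound on the paired domination number *)

Lemma gamma_pr_le (T : finType) (e : rel T) (S : {set T}) :
  paired_dominating e S -> gamma_pr e <= #|S|.
Proof.
move=> hS; rewrite /gamma_pr.
by have := Order.TotalTheory.bigmin_le_cond #|T| (fun S : {set T} => #|S|) hS; rewrite minEnat.
Qed.

Theorem theorem1 (T : finType) (e : rel T) :
  simple_graph e -> min_deg_ge e 4 ->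
  17 * gamma_pr e <= 10 * #|T|.
Proof.
move=> [esym eirr] dmin.
have [M [hM leM]] := exists_paired_cover esym eirr dmin setT.
have := gamma_pr_le (paired_cover_setT hM).
have := card_paired_cover hM.
(* From [170 * #|M| <= 50 * #|T|] follows [17 * (2 * #|M|) <= 10 * #|T|]. *)
by move: leM; rewrite phi_setT; clear; lia.
Qed.
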